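(* Let $r\ge 1$, $n\ge r+1$, and let $K$ be a pure $r$-dimensional simplicial complex on $n$ vertices that contains no subcomplex isomorphic to $\Delta_{r+2}^{r+1}$. Then $$\mathfrak{q}_{r-1}(K)\le rn-r^2+1,$$ with equality if and only if $|N^{\mathrm d}(F,u)|=r$ for every $F\in S_r(K)$ and every $u\in V(K)\setminus F$. Furthermore: (1) if $r=1$, equality holds if and only if $K$ is a complete bipartite graph (on all $n$ vertices); (2) if $r\ge 2$ is even, equality holds if and only if $K\cong {\sf T}_n^r$; (3) if $r\ge 3$ is odd, equality holds only if $K\cong{\sf T}_n^r$ or $K$ contains a subcomplex isomorphic to $\Diamond_{r+3}^{r+1}$.
   Context: A (finite abstract) simplicial complex $K$ on a finite vertex set $V(K)$ is a family of subsets of $V(K)$ closed under taking subsets and containing every singleton; it is on $n$ vertices if $|V(K)|=n$. An $i$-face is a member of cardinality $i+1$; $S_i(K)$ is the set of $i$-faces; facets are inclusion-maximal faces; $K$ is pure if all facets have the same dimension. A pure $1$-dimensional complex is identified with a graph without isolated vertices. For an $i$-face $F$, $d_K(F)$ is the number of $(i+1)$-faces containing $F$; two distinct $i$-faces are up-neighbors if their union is an $(i+1)$-face. The signless up Laplacian $Q_i^{\mathrm{up}}(K)$ is the operator on $\mathbb{R}^{S_i(K)}$ given by $(Q_i^{\mathrm{up}}(K)f)(F)=d_K(F)f(F)+\sum_{F'\text{ up-neighbor of }F}f(F')$, and $\mathfrak{q}_i(K)$ is its largest eigenvalue. For $F\in S_r(K)$ and $u\in V(K)\setminus F$, $N^{\mathrm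 d}(F,u)$ is the set of $r$-faces of $K$ of the form $G\cup\{u\}$ with $G\subset F$, $|G|=r$. $\Delta_{r+2}^{r+1}$ is the $r$-dimensional complex on $r+2$ vertices whose facets are all $(r+1)$-element subsets (the boundary of an $(r+1)$-simplex). The tented complex ${\sf T}_n^r$ is the pure $r$-dimensional complex on $[n]$ whose facets are the sets $\{n\}\cup F$ with $F$ an $r$-subset of $[n-1]$. The rhombic complex $\Diamond_{r+3}^{r+1}$ is the pure $r$-dimensional complex on $[r+3]$ whose facets are the sets $\{i\}\cup F$ with $i\in\{r+2,r+3\}$ and $F$ an $r$-subset of $[r+1]$. ''Contains'' / ''isomorphic'' refer to subcomplexes up to relabeling of vertices. *)

(* Defs.v *)
From HB Require Import structures.
From mathcomp Require Import all_boot all_order all_algebra.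
From mathcomp Require Import reals.
Set Implicit Arguments. Unset Strict Implicit. Unset Printing Implicit Defensive.
Import Order.TTheory GRing.Theory Num.Theory.
Local Open Scope ring_scope.

Section Complexes.
Variable T : finType.

Definition is_complex (K : {set {set T}}) : Prop :=
  (forall F G : {set T}, F \in K -> G \subset F -> G \in K) /\
  (forall v : T, [set v] \in K).

Definition faces (i : nat) (K : {set {set T}}) : {set {set T}} :=
  [set F in K | #|F| == i.+1].

Definition is_facet (K : {set {set T}}) (F : {set T}) : bool :=
  (F \in K) && [forall G in K, ~~ (F \proper G)].

Definition pure_dim (K : {set {set T}}) (r : nat) : Prop :=
  forall F : {set T}, is_facet K F -> #|F| = r.+1.

Definition updeg (i : nat) (K : {set {set T}}) (F : {set T}) : nat :=
  #|[set G in faces i.+1 K | F \subset G]|%N.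

Definition up_neighbor (i : nat) (K : {set {set T}}) (F F' : {set T}) : bool :=
  [&& F \in faces i K, F' \in faces i K, F != F' & F :|: F' \in faces i.+1 K].

Definition Qup (R : numFieldType) (i : nat) (K : {set {set T}}) :
  'M[R]_(#|faces i K|) :=
  \matrix_(a, b)
    (let F := enum_val a in let G := enum_val b in
     if F == G then (updeg i K F)%:R else (up_neighbor i K F G)%:R).

Definition Nd (r : nat) (K : {set {set T}}) (F : {set T}) (u : T) : {set {set T}} :=
  [set H in faces r K |
     [exists G : {set T}, [&& G \subset F, #|G| == r & H == u |: G]]].

Definition gen (Fs : {set {set T}}) : {set {set T}} :=
  [set G : {set T} | [exists F in Fs, G \subset F]].

Definition complete_bipartite (K : {set {set T}}) : Prop :=
  exists A : {set T}, [/\ A != set0, ~: A != set0 &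
     faces 1 K = [set [set a; b] | a in A, b in ~: A]].

End Complexes.

Definition largest_eigenvalue (R : realType) (m : nat) (M : 'M[R]_m) (q : R) : Prop :=
  eigenvalue M q /\ (forall mu : R, eigenvalue M mu -> mu <= q).

Definition q_sig (R : realType) (T : finType) (i : nat) (K : {set {set T}}) (q : R) :=
  largest_eigenvalue (Qup R i K) q.

Definition contains_copy (T U : finType) (K : {set {set T}}) (L : {set {set U}}) : Prop :=
  exists f : U -> T, injective f /\ (forall F : {set U}, F \in L -> f @: F \in K).

Definition iso_complex (T U : finType) (K : {set {set T}}) (L : {set {set U}}) : Prop :=
  exists f : U -> T, bijective f /\ (forall F : {set U}, (F \in L) = (f @: F \in K)).

Definition Delta (r : nat) : {set {set 'I_r.+2}} :=
  gen [set F : {set 'I_r.+2} | #|F| == r.+1].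

(* tented complex T_{m+1}^r on [m+1] = 'I_(m.+1) (0-indexed), apex the last
   vertex ord_max: facets {apex} U F, F an r-subset of the other vertices *)
Definition tented (m r : nat) : {set {set 'I_m.+1}} :=
  gen [set H : {set 'I_m.+1} |
        [exists F : {set 'I_m.+1},
           [&& ord_max \notin F, #|F| == r & H == ord_max |: F]]].

(* rhombic complex on [r+3] = 'I_(r.+3) (0-indexed): facets {i} U F with
   i in {r+1, r+2} (i.e. r+2, r+3 one-indexed) and F an r-subset of
   {0..r} (i.e. [r+1] one-indexed) *)
Definition rhombic (r : nat) : {set {set 'I_r.+3}} :=
  gen [set H : {set 'I_r.+3} |
        [exists i : 'I_r.+3, [exists F : {set 'I_r.+3},
           [&& (r.+1 <= i)%N, F \subset [set x : 'I_r.+3 | (x < r.+1)%N], #|F| == r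
             & H == i |: F]]]].

(* Main.v *)
(** Put Q = B B^T with B the incidence matrix between (r-1)-faces and r-faces. The
    nonzero spectrum of Q is that of B^T B, whose row sum at an r-face F is
    r + 1 + \sum_(u \notin F) |N^d(F, u)|; excluding Delta gives |N^d(F, u)| <= r, hence the
    bound. If it is attained, an r-face where the eigenvector is largest in absolute value
    has |N^d(F, u)| = r for all u and passes maximality on to its neighbours, and any r-face
    can be reached by exchanging vertices one at a time.

    In the extremal case every (r+2)-set spans 0 or r + 1 of the r-faces. If no nonface A has
    two cone points u, w over its boundary (a rhombus), the vertex z of F for which
    F - z + u is a nonface does not depend on u, and is shared by all r-faces: K is the
    tented complex with apex z. In a rhombus every (r+2)-subset of A + u + w spans exactly one
    nonface, and double counting gives r + 3 = 2 * #nonfaces, so r is odd. *)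
Require Import Defs.
From HB Require Import structures.
From mathcomp Require Import all_boot all_order all_algebra.
From mathcomp Require Import reals.
From mathcomp Require Import perm complex polyrcf boolp zify.
Set Implicit Arguments. Unset Strict Implicit. Unset Printing Implicit Defensive.
Import Order.TTheory GRing.Theory Num.Theory.
Local Open Scope ring_scope.

(** * Largest eigenvalue of a real symmetric matrix *)

Lemma max_root (R : rcfType) (p : {poly R}) (x : R) : p != 0 -> root p x ->
  exists q, root p q /\ forall y, root p y -> y <= q.
Proof.
move=> p0 rx.
have rootsE y : root p y = (y \in rootsR p).
  by rewrite -(roots_on_rootsR p0) in_itv.
exists (\big[Num.max/x]_(y <- rootsR p) y); split; last first.
  by move=> y; rewrite rootsE => yr; apply: (bigmax_sup_seq x y xpredT).
rewrite rootsE big_seq; apply: (big_ind (fun y => y \in rootsR p)) => [|a b ha hb|//].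
  by rewrite -rootsE.
by rewrite /Num.max; case: ifP.
Qed.

(** An eigenvector [v] exists over the complex closure, with eigenvalue [x]. Evaluating [v M vs] in
    two ways, with [vs] the conjugate transpose of [v], gives [x = x^*]. So [x] comes from [R] and
    is already a root of the real characteristic polynomial. *)
Lemma sym_eigenvalue_exists (R : rcfType) (m : nat) (M : 'M[R]_m) :
  M^T = M -> (0 < m)%N -> exists q, eigenvalue M q.
Proof.
move=> Msym m_gt0; pose toC := @real_complex R.
have /closed_rootP[x] : size (char_poly (map_mx toC M)) != 1%N.
  by rewrite size_char_poly -lt0n; case: (m) m_gt0.
rewrite -eigenvalue_root_char => /eigenvalueP[v vM v0].
pose vs := map_mx (@Num.conj R[i]) v^T.
have Mvs : map_mx toC M *m vs = x^* *: vs.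
  have := congr1 (fun w => map_mx (@Num.conj R[i]) w^T) vM.
  rewrite trmx_mul map_mxM linearZ /= map_mxZ => <-; congr (_ *m _).
  apply/matrixP=> i j; rewrite !mxE -{1}Msym mxE.
  by apply/esym/CrealP; rewrite /toC complex_real.
(* The product is the sum of the squared moduli of the entries of [v]. *)
have vvs : v *m vs != 0.
  apply: contra v0 => /eqP/matrixP/(_ 0 0); rewrite !mxE => /eqP.
  under eq_bigr do rewrite !mxE -normCK.
  rewrite psumr_eq0 => [/allP h|i _]; last by rewrite exprn_ge0.
  apply/eqP/rowP=> i; rewrite mxE; apply/eqP.
  by have := h i (mem_index_enum _); rewrite expf_eq0 normr_eq0.
have /eqP : v *m map_mx toC M *m vs = v *m (map_mx toC M *m vs) by rewrite mulmxA.
rewrite vM Mvs -scalemxAl -scalemxAr -subr_eq0 -scalerBl scaler_eq0 (negPf vvs).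
rewrite orbF subr_eq0 eq_sym => /eqP/CrealP/complex_realP[y xy].
exists y.
have ev : eigenvalue (map_mx toC M) x by apply/eigenvalueP; exists v.
move: ev; rewrite !eigenvalue_root_char -map_char_poly xy.
by rewrite fmorph_root.
Qed.

Lemma sym_largest_eigenvalue (R : realType) (m : nat) (M : 'M[R]_m) :
  M^T = M -> (0 < m)%N -> exists q, largest_eigenvalue M q.
Proof.
move=> Msym m_gt0; have [x] := sym_eigenvalue_exists Msym m_gt0.
rewrite eigenvalue_root_char => /(max_root (monic_neq0 (char_poly_monic M))).
move=> [q [rq qmax]]; exists q; split; first by rewrite eigenvalue_root_char.
by move=> mu; rewrite eigenvalue_root_char; apply: qmax.
Qed.

(** * Vertex exchanges in a face *)

Section Swaps.
Local Open Scope nat_scope.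
Variable T : finType.
Implicit Types (K : {set {set T}}) (F G H A : {set T}) (u v x z : T).

Definition swap F v u : {set T} := u |: (F :\ v).

(** The failed exchanges complement [Nd]: having |N^d(F, u)| = r amounts to having a single failed
    exchange, and excluding Delta amounts to having at least one. *)
Definition miss K F u : {set T} := [set v in F | swap F v u \notin K].

Lemma in_swap F v u x : (x \in swap F v u) = (x == u) || (x != v) && (x \in F).
Proof. by rewrite !inE. Qed.

Lemma card_swap F v u : v \in F -> u \notin F -> #|swap F v u| = #|F|.
Proof.
move=> vF uF; rewrite cardsU1 !inE (negPf uF) andbF (cardsD1 v F) vF.
by [].
Qed.

Lemma in_faces i K F : (F \in faces i K) = (F \in K) && (#|F| == i.+1).
Proof. by rewrite inE. Qed.

Lemma swap_faces i K F v u : F \in faces i K -> v \in F -> u \notin F ->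
  (swap F v u \in faces i K) = (swap F v u \in K).
Proof.
rewrite !in_faces => /andP[_ /eqP cF] vF uF.
by rewrite card_swap // cF eqxx andbT.
Qed.

Lemma subset_codim1 m F G : G \subset F -> #|F| = m.+1 -> #|G| = m ->
  exists2 v, v \in F & G = F :\ v.
Proof.
move=> GF cF cG.
have /eqP/cards1P[v Dv] : #|F :\: G| = 1.
  by rewrite cardsD (setIidPr GF) cF cG subSnn.
have /setDP[vF _] : v \in F :\: G by rewrite Dv inE.
exists v => //; apply/setP=> x; rewrite !inE.
move/setP: Dv => /(_ x); rewrite !inE => <-; rewrite negb_and negbK.
by case xG: (x \in G) => //=; [rewrite (subsetP GF) | case: (x \in F)].
Qed.

(** The members of [Nd] are the sets [swap F v u] lying in [K], and each determines [v] as the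
    vertex of [F] that it lacks. *)
Lemma card_Nd r K F u : F \in faces r K -> u \notin F ->
  #|Nd r K F u| + #|miss K F u| = r.+1.
Proof.
move=> FK uF; have /andP[_ /eqP cF] : (F \in K) && (#|F| == r.+1) by rewrite -in_faces.
have -> : Nd r K F u = [set swap F v u | v in [set v in F | swap F v u \in K]].
  apply/setP=> H; apply/idP/imsetP => [|[v]]; rewrite !inE.
    case/andP=> /andP[HK cH] /existsP[G /and3P[GF /eqP cG /eqP eH]].
    have [v vF eG] := subset_codim1 GF cF cG.
    have HE : H = swap F v u by rewrite eH eG.
    by exists v; rewrite // inE vF -HE.
  case/andP=> vF sK ->; rewrite sK card_swap // cF eqxx /=.
  apply/existsP; exists (F :\ v); rewrite subsetDl eqxx andbT /=.
  by move: cF; rewrite (cardsD1 v) vF add1n => -[->].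
rewrite card_in_imset; last first.
  move=> v w; rewrite !inE => /andP[vF _] /andP[wF _] /setP/(_ v).
  rewrite !in_swap eqxx vF /=; case: eqVneq => [e|_]; first by rewrite e (negPf uF) in vF.
  by case: eqVneq.
rewrite -cF -[RHS](cardsID [set v | swap F v u \in K]); congr (_ + _).
  by apply: eq_card => v; rewrite !inE.
by apply: eq_card => v; rewrite !inE andbC.
Qed.

Lemma big_ridges (R : Type) (idx : R) (op : Monoid.com_law idx) s K F (h : {set T} -> R) :
  (forall A B : {set T}, A \in K -> B \subset A -> B \in K) -> F \in faces s.+1 K ->
  \big[op/idx]_(G in faces s K | G \subset F) h G = \big[op/idx]_(v in F) h (F :\ v).
Proof.
move=> Kcl; rewrite in_faces => /andP[FK /eqP cF].
rewrite -(@big_imset _ _ _ _ _ (fun v => F :\ v)) /=; last first.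
  move=> v w vF wF /setP/(_ v); rewrite !inE eqxx vF /= andbT => /esym/negbT.
  by rewrite negbK => /eqP.
apply: eq_bigl => G; rewrite in_faces; apply/idP/imsetP => [|[v vF ->]].
  case/andP=> /andP[GK /eqP cG] GF.
  by have [v vF ->] := subset_codim1 GF cF cG; exists v.
rewrite (Kcl F) ?subsetDl // andbT /=.
by move: cF; rewrite (cardsD1 v) vF add1n => -[->].
Qed.

(** The cofaces of [F :\ v] are [F] itself, which accounts for the successor, and the faces
    [swap F v u] with [u] outside [F]. *)
Lemma updeg_ridge s K F v : F \in faces s.+1 K -> v \in F ->
  updeg s K (F :\ v) = (\sum_(u in ~: F) (swap F v u \in K)).+1.
Proof.
move=> FK vF; have /andP[FK' /eqP cF] : (F \in K) && (#|F| == s.+2) by rewrite -in_faces.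
rewrite /updeg -big_mkcondr /= sum1_card.
have -> : [set G in faces s.+1 K | F :\ v \subset G] =
   F |: [set swap F v u | u in [set u in ~: F | swap F v u \in K]].
  apply/setP=> H; rewrite !inE; apply/idP/idP.
    case/andP=> /andP[HK /eqP cH] sH.
    have cFv : #|F :\ v| = s.+1 by move: cF; rewrite (cardsD1 v) vF add1n => -[->].
    have /eqP/cards1P[u Du] : #|H :\: (F :\ v)| = 1.
      by rewrite cardsD (setIidPr sH) cH cFv subSnn.
    have HE : H = swap F v u.
      by rewrite /swap -(setID H (F :\ v)) Du (setIidPr sH) setUC.
    have [uF|uF] := boolP (u \in F).
      have /eqP uv : u == v.
        have : u \in H :\: (F :\ v) by rewrite Du inE.
        by rewrite !inE uF andbT negbK => /andP[].
      by rewrite HE uv /swap setD1K // eqxx.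
    by apply/orP; right; apply/imsetP; exists u; rewrite // !inE uF -HE.
  case/predU1P=> [->|/imsetP[u]]; first by rewrite FK' cF eqxx subsetDl.
  rewrite !inE => /andP[uF sK] ->.
  by rewrite sK card_swap // cF eqxx subsetUr.
rewrite cardsU1 card_in_imset; last first.
  move=> u w; rewrite !inE => /andP[uF _] /andP[wF _] /setP/(_ u).
  by rewrite !in_swap eqxx (negPf uF) !andbF !orbF => /esym/eqP.
rewrite -add1n; congr (_ + _); last by rewrite cardsE.
case: imsetP => // -[u]; rewrite !inE => /andP[uF _] /setP/(_ u).
by rewrite in_swap eqxx (negPf uF).
Qed.

(* Both sums count pairs (v, u) with v in F and u outside F, according to [swap F v u \in K]. *)
Lemma sum_updeg_miss s K F :
  (forall A B : {set T}, A \in K -> B \subset A -> B \in K) -> F \in faces s.+1 K ->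
  \sum_(G in faces s K | G \subset F) updeg s K G + \sum_(u in ~: F) #|miss K F u|
    = s.+2 + (#|T| - s.+2) * s.+2.
Proof.
move=> Kcl FK; have /andP[_ /eqP cF] : (F \in K) && (#|F| == s.+2) by rewrite -in_faces.
rewrite big_ridges //.
under eq_bigr => v vF do rewrite updeg_ridge // -addn1.
rewrite big_split /= sum1_card cF exchange_big /= addnC addnA -big_split addnC /=.
have cC : #|~: F| = #|T| - s.+2 by rewrite cardsCs setCK cF.
congr (_ + _); rewrite -cC -sum_nat_const; apply: eq_bigr => u uF.
rewrite -big_mkcondr /= sum1_card -cF -(cardsID [set v | swap F v u \in K] F).
rewrite [LHS]addnC; congr (_ + _).
  by rewrite -cardsE; apply: eq_card => v; rewrite !inE.
by apply: eq_card => v; rewrite !inE andbC.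
Qed.

(* Walk from F0 to G, each step exchanging an element outside G for one of G: when at least two
   elements of F lie outside G, one of the exchanges avoids [miss]; when only one does, the
   exchange yields G itself. *)
Lemma faces_swap_ind r K (P : {set T} -> Prop) F0 :
  F0 \in faces r K -> P F0 ->
  (forall F u, F \in faces r K -> P F -> u \notin F -> #|miss K F u| <= 1) ->
  (forall F v u, F \in faces r K -> P F -> v \in F -> u \notin F -> swap F v u \in K ->
     P (swap F v u)) ->
  forall G, G \in faces r K -> P G.
Proof.
move=> F0K PF0 miss1 step G GK.
have [m] := ubnP #|G :\: F0|.
elim: m F0 F0K PF0 => // m IH F FK PF; rewrite ltnS => lem.
have /andP[_ /eqP cF] : (F \in K) && (#|F| == r.+1) by rewrite -in_faces.
have /andP[GK' /eqP cG] : (G \in K) && (#|G| == r.+1) by rewrite -in_faces.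
have cD : #|F :\: G| = #|G :\: F| by rewrite !cardsD cF cG setIC.
case: (set_0Vmem (G :\: F)) => [D0|[u]].
  have /eqP -> // : G == F by rewrite eqEcard -setD_eq0 D0 eqxx cF cG leqnn.
rewrite inE => /andP[uF uG].
have closer v : v \in F -> v \notin G -> #|G :\: swap F v u| < #|G :\: F|.
  move=> vF vG; apply/proper_card/properP; split.
    apply/subsetP=> x; rewrite !inE negb_or; case: (eqVneq x v) => [->|_] /=.
      by rewrite (negPf vG) andbF.
    by case/andP=> /andP[_ ->] ->.
  by exists u; rewrite !inE ?uF ?eqxx.
have [v /setDP[vF vG] vK] : exists2 v, v \in F :\: G & swap F v u \in K.
  case: (leqP #|F :\: G| 1) => [le1|gt1].
    have c1 : #|F :\: G| = 1.
      by apply/eqP; rewrite eqn_leq le1 cD card_gt0; apply/set0Pn; exists u; rewrite inE uF.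
    have /eqP/cards1P[v Dv] := c1.
    have vD : v \in F :\: G by rewrite Dv inE.
    exists v => //; move: vD; rewrite inE => /andP[vG vF].
    have /eqP -> // : swap F v u == G.
    rewrite eq_sym eqEcard card_swap // cF cG leqnn andbT -setD_eq0 -cards_eq0.
    by rewrite -leqn0 -ltnS -c1 cD closer.
  have /subsetPn[v vD vm] : ~~ (F :\: G \subset miss K F u).
    by apply: contraL gt1 => /subset_leq_card le; rewrite -leqNgt (leq_trans le) ?miss1.
  exists v => //; move: vm vD; rewrite !inE negb_and negbK.
  by case: (v \in F); rewrite ?andbF.
apply: (IH (swap F v u)); first by rewrite swap_faces.
  exact: step.
exact: leq_trans (closer v vF vG) lem.
Qed.

End Swaps.

(** * The spectral bound and its equality case *)

Section Spectrum.
Variables (R : realType) (T : finType) (s : nat) (K : {set {set T}}).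
Implicit Types (F G H : {set T}) (q : R).

(* Q = B B^T with B the incidence matrix of s-faces and (s+1)-faces. *)
Lemma QupE a b : Qup R s K a b =
  \sum_(F in faces s.+1 K | enum_val b \subset F) (enum_val a \subset F)%:R.
Proof.
rewrite mxE; have := enum_valP a; have := enum_valP b.
move: (enum_val a) (enum_val b) => A B BK AK.
rewrite -natr_sum -big_mkcondr /= sum1_card.
have [<-|nAB] /= := eqVneq A B.
  congr (_%:R); rewrite /updeg; apply: eq_card => F.
  by rewrite !inE [RHS]unfold_in !inE -!andbA andbb.
rewrite /up_neighbor AK BK nAB /=; congr (_%:R).
have cA : #|A| = s.+1 by move: AK; rewrite in_faces => /andP[_ /eqP].
have cB : #|B| = s.+1 by move: BK; rewrite in_faces => /andP[_ /eqP].
(* Off the diagonal, only the union of the two s-faces can be an (s+1)-face containing both, so the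
   sum is 0 or 1. *)
have cAB F : A \subset F -> B \subset F -> #|F| = s.+2 -> F = A :|: B.
  move=> AF BF cF; apply/esym/eqP; rewrite eqEcard subUset AF BF cF /=.
  rewrite -cA; apply: proper_card; rewrite properEneq subsetUl andbT.
  apply: contra nAB => /eqP e.
  by rewrite eq_sym eqEcard cA cB leqnn andbT e subsetUr.
case ABK: (A :|: B \in faces s.+1 K).
  rewrite -[LHS](cards1 (A :|: B)); apply: eq_card => F; rewrite !inE unfold_in.
  apply/eqP/idP => [->|/andP[/andP[]]]; first by rewrite ABK subsetUl subsetUr.
  by rewrite in_faces => /andP[_ /eqP cF] BF AF; apply: cAB.
apply/esym/eq_card0 => F; rewrite !inE unfold_in; apply/negP => /andP[/andP[FK BF] AF].
move: (FK); rewrite in_faces => /andP[_ /eqP cF].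
by rewrite (cAB F) // ABK in FK.
Qed.

Lemma Qup_sym : (Qup R s K)^T = Qup R s K.
Proof.
apply/matrixP=> a b; rewrite mxE !QupE !big_mkcondr /=; apply: eq_bigr => F _.
by do 2 case: (_ \subset _).
Qed.

Lemma mul_Qup (v : 'rV[R]_#|faces s K|) b : (v *m Qup R s K) 0 b =
  \sum_(F in faces s.+1 K | enum_val b \subset F)
    \sum_a v 0 a * (enum_val a \subset F)%:R.
Proof.
rewrite mxE exchange_big /=; apply: eq_bigr => a _.
by rewrite QupE mulr_sumr.
Qed.

(** The weights are [g = B^T v], which satisfy [B^T B g = q g]. They do not all vanish on
    (s+1)-faces, since [B g = q v] with [q] and [v] nonzero. *)
Lemma Qup_eigen_weights q : eigenvalue (Qup R s K) q -> q != 0 ->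
  exists g : {set T} -> R, (exists2 F, F \in faces s.+1 K & g F != 0) /\
    forall F, q * g F =
      \sum_(G in faces s K | G \subset F) \sum_(H in faces s.+1 K | G \subset H) g H.
Proof.
case/eigenvalueP=> v vQ v0 q0.
pose g F := \sum_a v 0 a * (enum_val a \subset F)%:R.
have vg a : q * v 0 a = \sum_(H in faces s.+1 K | enum_val a \subset H) g H.
  by rewrite -mul_Qup vQ mxE.
exists g; split; last first.
  move=> F; rewrite mulr_sumr big_enum_val_cond /= [RHS]big_mkcond /=; apply: eq_bigr => a _.
  by rewrite mulrA vg; case: ifP; rewrite (mulr1, mulr0).
apply/exists_inP; apply: contraR v0 => /exists_inPn g0.
apply/eqP/rowP=> a; rewrite mxE; apply/eqP.
have : q * v 0 a == 0.
  rewrite vg big1 // => H /andP[HK _]; apply/eqP.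
  by have := g0 H HK; rewrite negbK.
by rewrite mulf_eq0 (negPf q0).
Qed.

Hypothesis Kcl : forall A B : {set T}, A \in K -> B \subset A -> B \in K.

(** Constant row sums make the all-ones vector an eigenvector of [B^T B]. Its image under [B] is the
    vector of up-degrees, nonzero because a ridge of [F0] has positive degree. *)
Lemma Qup_eigen_updeg (m : nat) F0 : F0 \in faces s.+1 K ->
  (forall F, F \in faces s.+1 K ->
     (\sum_(G in faces s K | G \subset F) updeg s K G = m)%N) ->
  eigenvalue (Qup R s K) m%:R.
Proof.
move=> F0K rowsum; apply/eigenvalueP.
exists (\row_a (updeg s K (enum_val a))%:R).
  apply/rowP=> b; rewrite mul_Qup mxE.
  rewrite (eq_bigr (fun=> m%:R)) => [|F /andP[FK _]]; last first.
    rewrite -(rowsum F FK) big_enum_val_cond /= natr_sum big_mkcond [in RHS]big_mkcond /=.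
    by apply: eq_bigr => a _; rewrite mxE; case: ifP; rewrite (mulr1, mulr0).
  rewrite sumr_const ?mxE -[LHS]mulr_natr; congr (_ * _%:R).
  by apply: eq_card => F; rewrite !inE [LHS]unfold_in !inE.
have /andP[F0K' /eqP cF] : (F0 \in K) && (#|F0| == s.+2) by rewrite -in_faces.
have [v vF] : exists v, v \in F0 by apply/card_gt0P; rewrite cF.
have GK : F0 :\ v \in faces s K.
  rewrite in_faces (Kcl F0K') ?subsetDl //=.
  by move: cF; rewrite (cardsD1 v) vF add1n => -[->].
apply/eqP => /rowP/(_ (enum_rank_in GK (F0 :\ v)))/eqP.
by rewrite !mxE enum_rankK_in // updeg_ridge // pnatr_eq0.
Qed.

Section Bound.
Hypothesis miss_gt0 : forall F u, F \in faces s.+1 K -> u \notin F ->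
  (0 < #|miss K F u|)%N.

(** For r = s + 1 and n = [#|T|] at least r + 1, this is rn - r^2 + 1, written as the row sum of
    [B^T B] at a face where every outside vertex fails exactly one exchange. *)
Let bnd := (s.+2 + (#|T| - s.+2) * s.+1)%N.

Lemma card_setC_face F : F \in faces s.+1 K -> #|~: F| = (#|T| - s.+2)%N.
Proof. by rewrite in_faces => /andP[_ /eqP cF]; rewrite cardsCs setCK cF. Qed.

Lemma sum_updeg_le F : F \in faces s.+1 K ->
  (\sum_(G in faces s K | G \subset F) updeg s K G <= bnd)%N.
Proof.
move=> FK; have := sum_updeg_miss Kcl FK.
have : (\sum_(u in ~: F) 1 <= \sum_(u in ~: F) #|miss K F u|)%N.
  by apply: leq_sum => u; rewrite inE; apply: miss_gt0.
rewrite sum1_card card_setC_face // /bnd; lia.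
Qed.

(** The row sum and the number of failed exchanges add up to a constant, and each outside vertex
    contributes at least one failure; so the bound is met exactly when each contributes one. *)
Lemma sum_updeg_eq F : F \in faces s.+1 K ->
  reflect (forall u, u \notin F -> #|miss K F u| = 1%N)
    (\sum_(G in faces s K | G \subset F) updeg s K G == bnd)%N.
Proof.
move=> FK; have eq1 := sum_updeg_miss Kcl FK.
have le1 : forall u, u \in ~: F -> (1 <= #|miss K F u| ?= iff (#|miss K F u| == 1))%N.
  by move=> u; rewrite inE => uF; split; [apply: miss_gt0 | rewrite eq_sym].
have [] := leqif_sum le1.
rewrite sum1_card card_setC_face // => le2 eq2.
apply: (iffP idP) => [/eqP e u uF | e].
  have /forall_inP h : [forall (i | i \in ~: F), #|miss K F i| == 1]%N.
    rewrite -eq2; apply/eqP; move: eq1; rewrite e /bnd; nia.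
  by apply/eqP/h; rewrite inE.
suff : (#|T| - s.+2 == \sum_(i in ~: F) #|miss K F i|)%N.
  by move/eqP => e2; apply/eqP; move: eq1; rewrite -e2 /bnd; nia.
by rewrite eq2; apply/forall_inP => u; rewrite inE => /e ->.
Qed.

Lemma bnd_gt0 : 0 < bnd%:R :> R.
Proof. by rewrite ltr0n. Qed.

(** Since [B^T B] has nonnegative entries, passing to absolute values of the weights turns the
    eigenvalue equation into an inequality by the triangle inequality. [M] is the largest absolute
    value on (s+1)-faces. *)
Lemma Qup_max_weight q : eigenvalue (Qup R s K) q -> 0 < q ->
  exists g : {set T} -> R, exists M : R,
  [/\ 0 < M, exists2 F, F \in faces s.+1 K & g F = M,
      forall F, F \in faces s.+1 K -> g F <= M &
      forall F, q * g F <=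
        \sum_(G in faces s K | G \subset F) \sum_(H in faces s.+1 K | G \subset H) g H].
Proof.
move=> ev q_gt0; have [g [[F1 F1K gF1] gE]] := Qup_eigen_weights ev (lt0r_neq0 q_gt0).
case: (@arg_maxP _ _ _ F1 (mem (faces s.+1 K)) (fun F => `|g F|) F1K) => F0 F0K F0max.
exists (fun F => `|g F|), `|g F0|; split=> //.
- by apply: lt_le_trans (F0max _ F1K); rewrite normr_gt0.
- by exists F0.
move=> F; rewrite -{1}(ger0_norm (ltW q_gt0)) -normrM gE.
apply: le_trans (ler_norm_sum _ _ _) _; apply: ler_sum => G _.
exact: ler_norm_sum.
Qed.

Lemma sum_updegM (M : R) F :
  \sum_(G in faces s K | G \subset F) \sum_(H in faces s.+1 K | G \subset H) M
    = (\sum_(G in faces s K | G \subset F) updeg s K G)%:R * M.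
Proof.
rewrite natr_sum mulr_suml; apply: eq_bigr => G _.
rewrite sumr_const -[LHS]mulr_natl /updeg; congr (_%:R * _).
by apply: eq_card => H; rewrite !inE [LHS]unfold_in !inE.
Qed.

Lemma Qup_eigenvalue_le q : eigenvalue (Qup R s K) q -> q <= bnd%:R.
Proof.
move=> ev; have [q_le0|q_gt0] := leP q 0; first exact: le_trans (ltW bnd_gt0).
have [g [M [M_gt0 [F FK gF] gM qg]]] := Qup_max_weight ev q_gt0.
rewrite -(ler_pM2r M_gt0) -{1}gF; apply: le_trans (qg F) _.
apply: (@le_trans _ _ ((\sum_(G in faces s K | G \subset F) updeg s K G)%:R * M)).
  by rewrite -sum_updegM; apply: ler_sum => G _; apply: ler_sum => H /andP[HK _]; apply: gM.
by rewrite ler_pM2r // ler_nat sum_updeg_le.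
Qed.

Lemma Qup_eigenvalue_eq : eigenvalue (Qup R s K) bnd%:R ->
  forall F u, F \in faces s.+1 K -> u \notin F -> #|miss K F u| = 1%N.
Proof.
move=> ev; have [g [M [M_gt0 [F0 F0K gF0] gM qg]]] := Qup_max_weight ev bnd_gt0.
have tight F : F \in faces s.+1 K -> g F = M -> 
    (\sum_(G in faces s K | G \subset F) updeg s K G == bnd)%N.
  move=> FK gF; rewrite eqn_leq sum_updeg_le //= -(ler_nat R) -(ler_pM2r M_gt0).
  rewrite -{1}gF; apply: le_trans (qg F) _; rewrite -sum_updegM.
  by apply: ler_sum => G _; apply: ler_sum => H /andP[HK _]; apply: gM.
have nbr F v u : F \in faces s.+1 K -> g F = M -> v \in F -> u \notin F -> swap F v u \in K ->
    g (swap F v u) = M.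
  move=> FK gF vF uF sK.
  have HK : swap F v u \in faces s.+1 K by rewrite swap_faces.
  (* The total slack [M - g H] around [F] is at most [bnd * M - bnd * g F = 0]; as its terms are
     nonnegative, each vanishes. *)
  have le0 : \sum_(w in F) \sum_(H in faces s.+1 K | F :\ w \subset H) (M - g H) <= 0.
    rewrite -(@big_ridges _ _ _ _ s K F (fun G => \sum_(H in faces s.+1 K | G \subset H) (M - g H)) Kcl FK).
    under eq_bigr do rewrite sumrB.
    rewrite sumrB subr_le0 sum_updegM (eqP (tight F FK gF)) -{1}gF; exact: qg.
  have in0 w : w \in F -> 0 <= \sum_(H in faces s.+1 K | F :\ w \subset H) (M - g H).
    by move=> _; apply: sumr_ge0 => H /andP[H1 _]; rewrite subr_ge0 gM.
  have eq0 := le_anti (introT andP (conj le0 (sumr_ge0 _ in0))).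
  have inH H : (H \in faces s.+1 K) && (F :\ v \subset H) -> 0 <= M - g H.
    by case/andP=> H1 _; rewrite subr_ge0 gM.
  have h := psumr_eq0P inH (psumr_eq0P in0 eq0 vF).
  by apply/esym/eqP; rewrite -subr_eq0 h // HK subsetUr.
(* The walk needs at most one failed exchange only at faces already known to have weight [M], where
   [tight] supplies it. *)
have gE := @faces_swap_ind _ s.+1 K (fun F => g F = M) F0 F0K gF0 _ nbr.
move=> F u FK uF; apply: (elimT (sum_updeg_eq FK) (tight F FK _)) => //.
apply: gE => // F' u' F'K gF' u'F.
by rewrite (elimT (sum_updeg_eq F'K) (tight F' F'K gF')).
Qed.

End Bound.
End Spectrum.

(** * Structure of the extremal complexes *)

Section Structure.
Local Open Scope nat_scope.
Variables (T : finType) (r : nat) (K : {set {set T}}).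
Implicit Types (A B F G H : {set T}) (u v w x z : T).

Lemma swap_swap F v u w : u \notin F -> swap (swap F v u) u w = swap F v w.
Proof.
move=> uF; apply/setP=> x; rewrite !in_swap.
by case: (eqVneq x u) => [->|_] //=; rewrite (negPf uF) andbF.
Qed.

Lemma swap_id F v : v \in F -> swap F v v = F.
Proof. exact: setD1K. Qed.

Lemma swap_back F v v' u : v \in F -> v' \in F -> u \notin F -> v' != v ->
  swap (swap F v u) v' v = swap F v' u.
Proof.
move=> vF v'F uF nv; apply/setP=> x; rewrite !in_swap.
case: (eqVneq x v) => [->|_] /=; first by rewrite vF (eq_sym v v') nv orbT.
by case: (eqVneq x u) => [->|_] //=; case: eqP uF => // ->; rewrite v'F.
Qed.

(** Without failed exchanges, every (r+1)-subset of [u |: F] is a face, so listing the r + 2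
    elements of that set embeds the simplex boundary. *)
Lemma miss0_contains_Delta F u :
  (forall A B : {set T}, A \in K -> B \subset A -> B \in K) ->
  F \in faces r K -> u \notin F -> miss K F u = set0 -> contains_copy K (Delta r).
Proof.
move=> Kcl; rewrite in_faces => /andP[FK /eqP cF] uF m0.
pose W := u |: F; have cW : #|W| = r.+2 by rewrite cardsU1 uF cF.
have sz : size (enum W) = r.+2 by rewrite -cardE.
pose f (i : 'I_r.+2) := nth u (enum W) i.
have f_inj : injective f.
  by move=> i j /eqP; rewrite nth_uniq ?sz ?enum_uniq ?ltn_ord // => /eqP/ord_inj.
have fW i : f i \in W by rewrite -mem_enum mem_nth ?sz.
exists f; split=> // G; rewrite inE => /exists_inP[H]; rewrite inE => /eqP cH GH.
apply: Kcl (imsetS f GH).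
have [|||v] := @subset_codim1 _ r.+1 W (f @: H).
- by apply/subsetP=> _ /imsetP[i _ ->].
- by [].
- by rewrite card_imset.
rewrite !inE => vW ->; case: (eqVneq v u) vW => [->|vu] /= vF; first by rewrite setU1K.
have -> : W :\ v = swap F v u.
  apply/setP=> x; rewrite !inE; case: (eqVneq x u) => [->|_] //=.
  by rewrite eq_sym vu.
by move/setP: m0 => /(_ v); rewrite !inE vF /= => /negbFE.
Qed.

(* The only obstruction to being a tent: two cone points over the boundary of a nonface. *)
Definition rhombus A u w := [/\ A \notin K, #|A| = r.+1, (u \notin A) && (w \notin A), u != w &
  forall v, v \in A -> (swap A v u \in K) && (swap A v w \in K)].

(** The indices below r + 1 list [A], and the last two are sent to [u] and [w]. *)
Lemma rhombus_contains A u w :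
  (forall A B : {set T}, A \in K -> B \subset A -> B \in K) ->
  rhombus A u w -> contains_copy K (rhombic r).
Proof.
move=> Kcl [AK cA /andP[uA wA] uw full].
pose e := enum A ++ [:: u; w].
have szA : size (enum A) = r.+1 by rewrite -cardE.
have sz : size e = r.+3 by rewrite size_cat szA addn2.
have ue : uniq e.
  rewrite cat_uniq enum_uniq /= !mem_enum !inE (negPf uA) (negPf wA) /=.
  by rewrite uw.
pose f (i : 'I_r.+3) := nth u e i.
have f_inj : injective f.
  by move=> i j /eqP; rewrite nth_uniq ?sz ?ltn_ord // => /eqP/ord_inj.
exists f; split=> // G; rewrite inE => /exists_inP[H].
rewrite inE => /existsP[i /existsP[F /and4P[ri Fr /eqP cF /eqP ->]]] GH.
apply: Kcl (imsetS f GH).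
have fA (j : 'I_r.+3) : j < r.+1 -> f j \in A.
  by move=> lj; rewrite /f nth_cat szA lj -mem_enum mem_nth ?szA.
have [|||v vA FE] := @subset_codim1 _ r A (f @: F); rewrite ?card_imset //.
  by apply/subsetP=> y /imsetP[j /(subsetP Fr)]; rewrite inE => lj ->; apply: fA.
rewrite imsetU1 FE -/(swap A v (f i)).
have /andP[Ku Kw] := full v vA.
have : i - r.+1 < 2 by have := ltn_ord i; lia.
by rewrite /f nth_cat szA (ltnNge i r.+1) ri /=; case: (i - r.+1) => [|[|]].
Qed.

Hypothesis star : forall F u, F \in faces r K -> u \notin F -> #|miss K F u| = 1.

(** In the face [F = swap A v u], bringing [v] back in place of [u] gives the nonface [A]. This is
    the only failed exchange for [v], so bringing [v] back in place of any other [v'] gives the face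
    [swap A v' u]. *)
Lemma nonface_full A u v : A \notin K -> #|A| = r.+1 -> u \notin A -> v \in A ->
  swap A v u \in K -> forall v', v' \in A -> swap A v' u \in K.
Proof.
move=> AK cA uA vA FK v' v'A; case: (eqVneq v' v) => [-> //|nv].
set F := swap A v u in FK.
have FK' : F \in faces r K by rewrite in_faces FK card_swap // cA eqxx.
have vF : v \notin F.
  by rewrite in_swap eqxx orbF; apply: contraNneq uA => <-.
have /eqP/cards1P[x Dx] := star FK' vF.
have um : u \in miss K F v by rewrite inE in_swap eqxx /F swap_swap // swap_id.
have v'u : v' != u by apply: contraNneq uA => <-.
rewrite -(swap_back vA v'A uA nv) -/F; apply/negPn/negP => nK.
have v'm : v' \in miss K F v by rewrite inE in_swap nv v'A orbT.
by move: um v'm; rewrite Dx !inE => /eqP ux /eqP vx; rewrite vx ux eqxx in v'u.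
Qed.

(** Otherwise the nonface [A = swap F z u] has cone points [z] and [w]: replacing [u] in [A] by them
    gives the faces [F] and [swap F z w], and [nonface_full] extends this to all vertices of [A]. *)
Lemma apex_const F z u w : (forall A u w, ~ rhombus A u w) ->
  F \in faces r K -> z \in F -> u \notin F -> w \notin F ->
  swap F z u \notin K -> swap F z w \notin K.
Proof.
move=> norh FK zF uF wF uK; apply/negP=> wK.
move: (FK); rewrite in_faces => /andP[FK' /eqP cF].
have uw : u != w by apply: contraNneq uK => ->.
have zu : z != u by apply: contraNneq uF => <-.
have zw : z != w by apply: contraNneq wF => <-.
pose A := swap F z u.
have uA : u \in A by rewrite in_swap eqxx.
have zA : z \notin A by rewrite in_swap eqxx orbF.
have wA : w \notin A by rewrite in_swap (negPf wF) andbF orbF eq_sym.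
have cA : #|A| = r.+1 by rewrite card_swap.
apply: (norh A z w); split=> // [|v vA]; first by rewrite zA.
apply/andP; split.
  by apply: (@nonface_full A z u) => //; rewrite swap_swap // swap_id.
by apply: (@nonface_full A w u) => //; rewrite swap_swap.
Qed.

Lemma tent_of_star F0 : (forall A u w, ~ rhombus A u w) -> F0 \in faces r K ->
  exists z, forall G, #|G| = r.+1 -> (G \in K) = (z \in G).
Proof.
move=> norh F0K.
have [z zF0 zP] : exists2 z, z \in F0 & forall u, u \notin F0 -> swap F0 z u \notin K.
  case: (set_0Vmem (~: F0)) => [C0|[u]].
    have /card_gt0P[z zF] : 0 < #|F0|.
      by move: F0K; rewrite in_faces => /andP[_ /eqP ->].
    by exists z => // u; rewrite -in_setC C0 inE.
  rewrite inE => uF; have /eqP/cards1P[z Dz] := star F0K uF.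
  have : z \in miss K F0 u by rewrite Dz inE.
  rewrite inE => /andP[zF zK]; exists z => // w wF.
  exact: apex_const zK.
have allP : forall G, G \in faces r K ->
    z \in G /\ forall u, u \notin G -> swap G z u \notin K.
  apply: (faces_swap_ind F0K) => //.
    by move=> F u FK _ uF; rewrite star.
  move=> F v u FK [zF zu] vF uF sK.
  have zv : z != v by apply: contraNneq (zu u uF) => ->.
  have zs : z \in swap F v u by rewrite in_swap zv zF orbT.
  have vs : v \notin swap F v u.
    by rewrite in_swap eqxx orbF; apply: contraNneq uF => <-.
  have sK' : swap F v u \in faces r K by rewrite swap_faces.
  (* Exchanging [z] for [v] in the new face gives [swap F z u], a nonface by induction; [apex_const]
     carries this to every outside [w]. *)
  split=> // w wF; apply: (apex_const norh sK' zs vs wF).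
  by rewrite swap_back // zu.
exists z => G cG; apply/idP/idP => [GK|zG].
  by have [] := allP G; rewrite // in_faces GK cG eqxx.
(* For the converse, the walk takes place in the family of all sets containing [z], where only
   removing [z] can fail. Each step stays in [K] because the one failed exchange there is already
   that of [z]. *)
have inz F : (F \in faces r [set H : {set T} | z \in H]) = (z \in F) && (#|F| == r.+1).
  by rewrite in_faces inE.
apply: (@faces_swap_ind _ r [set H : {set T} | z \in H] (fun F => F \in K) F0); rewrite ?inz ?zG ?cG ?eqxx //.
- by rewrite zF0; move: F0K; rewrite in_faces => /andP[].
- by move: F0K; rewrite in_faces => /andP[].
- move=> F u; rewrite inz => /andP[zF _] _ _.
  rewrite -(cards1 z); apply/subset_leq_card/subsetP=> x; rewrite !inE zF andbT.
  by case/andP=> _; rewrite negb_or negbK => /andP[_ /eqP ->].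
- move=> F v u; rewrite inz => /andP[zF cF] FK vF uF; rewrite inE in_swap => zs.
  have FK' : F \in faces r K by rewrite in_faces FK.
  have [_ /(_ u uF) zK] := allP F FK'.
  have /eqP/cards1P[x Dx] := star FK' uF.
  have zx : z = x by apply/set1P; rewrite -Dx inE zF.
  apply/negPn/negP=> sK; have vx : v = x by apply/set1P; rewrite -Dx inE vF.
  by move: zs; rewrite vx zx eqxx orbF => /eqP e; rewrite -e -zx zF in uF.
Qed.

(** Besides the face [F], the (r+1)-subsets of [u |: F] are the exchanges [swap F v u], exactly one
    of which fails. *)
Lemma card_nonfaces F u : F \in faces r K -> u \notin F ->
  #|[set B : {set T} | [&& B \subset u |: F, #|B| == r.+1 & B \notin K]]| = 1.
Proof.
move=> FK uF; have /eqP/cards1P[z Dz] := star FK uF.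
move: (FK); rewrite in_faces => /andP[FK' /eqP cF].
have sE v : v \in F -> (u |: F) :\ v = swap F v u.
  move=> vF; apply/setP=> x; rewrite !inE; case: (eqVneq x u) => [->|_] //=.
  by rewrite andbT; apply: contraNneq uF => ->.
have : z \in miss K F u by rewrite Dz inE.
rewrite inE => /andP[zF zK].
apply/eqP/cards1P; exists (swap F z u); apply/setP=> B; rewrite !inE.
apply/and3P/eqP => [[BX /eqP cB BK]|->]; last first.
  by rewrite -{1}sE // subsetDl card_swap // cF.
have [|v] := subset_codim1 BX _ cB; first by rewrite cardsU1 uF cF.
rewrite !inE => /predU1P[->|vF] BE.
  by move: BK; rewrite BE setU1K // FK'.
have /set1P <- : v \in [set z] by rewrite -Dz inE vF -sE // -BE.
by rewrite BE sE.
Qed.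

(* The complements in X = A + u + w of the nonfaces form a perfect matching of X,
   which is a set of r + 3 elements. *)
Lemma rhombus_odd A u w : rhombus A u w -> odd r.
Proof.
case=> AK cA /andP[uA wA] uw full.
pose X := u |: (w |: A).
have cX : #|X| = r.+3 by rewrite !cardsU1 !inE negb_or uw uA wA cA.
pose N := [set B : {set T} | [&& B \subset X, #|B| == r.+1 & B \notin K]].
have facet v y : v \in A -> y \in [set u; w] -> swap A v y \in faces r K.
  move=> vA yuw; have /andP[Ku Kw] := full v vA.
  by move: yuw; rewrite !inE => /orP[] /eqP ->; rewrite ?Ku ?Kw card_swap // cA eqxx.
have /card_gt0P[v0 v0A] : 0 < #|A| by rewrite cA.
have v0u : v0 != u by apply: contraNneq uA => <-.
have v0w : v0 != w by apply: contraNneq wA => <-.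
(* Each [X :\ x] is a face of the rhombus plus one vertex, so [card_nonfaces] finds exactly one
   nonface in it. *)
have faceX x : x \in X -> exists2 F, F \in faces r K & exists2 y, y \notin F & X :\ x = y |: F.
  rewrite !inE; case: (eqVneq x u) => [->|xu] /=.
    move=> _; exists (swap A v0 w); first by rewrite facet // !inE eqxx orbT.
    exists v0; first by rewrite in_swap eqxx orbF.
    rewrite /X setU1K ?inE ?negb_or ?uw //; apply/setP=> y; rewrite !inE.
    by case: (eqVneq y v0) => [->|]; rewrite ?v0A ?orbT.
  case: (eqVneq x w) => [->|xw] /= xA.
    exists (swap A v0 u); first by rewrite facet // !inE eqxx.
    exists v0; first by rewrite in_swap eqxx orbF.
    rewrite /X setUCA setU1K ?inE ?negb_or ?(eq_sym w) ?uw //; apply/setP=> y; rewrite !inE.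
    by case: (eqVneq y v0) => [->|]; rewrite ?v0A ?orbT.
  exists (swap A x u); first by rewrite facet // !inE eqxx.
  exists w; first by rewrite in_swap eq_sym (negPf uw) (negPf wA) andbF.
  apply/setP=> y; rewrite !inE; case: (eqVneq y u) => [->|_] /=.
    by rewrite eq_sym xu orbT.
  by case: (eqVneq y w) => [->|_] //=; rewrite eq_sym xw.
have : \sum_(x in X) \sum_(B in N) (x \notin B) = \sum_(x in X) 1.
  apply: eq_bigr => x xX; have [F FK [y yF XE]] := faceX x xX.
  rewrite -big_mkcondr /= sum1_card -(card_nonfaces FK yF); apply: eq_card => B.
  rewrite [LHS]unfold_in !inE -XE subsetD1.
  by case: (B \subset X); case: (x \notin B); rewrite ?andbT ?andbF.
rewrite exchange_big /= sum1_card cX (eq_bigr (fun=> 2)).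
  by rewrite sum_nat_const => /(congr1 odd); rewrite oddM andbF /= => /esym/negbFE/negPn.
move=> B; rewrite inE => /and3P[BX /eqP cB _].
rewrite -big_mkcondr /= sum1_card -[RHS](_ : #|X :\: B| = 2); last first.
  by rewrite cardsD (setIidPr BX) cX cB; lia.
by apply: eq_card => x; rewrite [LHS]unfold_in !inE andbC.
Qed.

End Structure.

(** * Recognising tented complexes and complete bipartite graphs *)

Section Recognition.
Local Open Scope nat_scope.

Lemma pure_face_ext (T : finType) (K : {set {set T}}) r F : pure_dim K r -> F \in K ->
  exists2 G, G \in faces r K & F \subset G.
Proof.
move=> Kpure FK; have [G /maxsetP[GK Gmax] FG] := maxset_exists (P := mem K) FK.
have {}GK : G \in K := GK.
exists G => //; rewrite in_faces GK; apply/eqP/Kpure.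
rewrite /is_facet GK; apply/forall_inP => H HK; apply/negP=> /properP[GH [x xH]].
by rewrite -(Gmax H) // xH.
Qed.

(** The single exchange leaving [K] is the one that removes the apex [z]. *)
Lemma tent_star (T : finType) (K : {set {set T}}) r z :
  (forall G : {set T}, #|G| = r.+1 -> (G \in K) = (z \in G)) ->
  forall F u, F \in faces r K -> u \notin F -> #|miss K F u| = 1.
Proof.
move=> tent F u; rewrite in_faces => /andP[FK /eqP cF] uF.
have zF : z \in F by rewrite -tent.
apply/eqP/cards1P; exists z; apply/setP=> v; rewrite !inE.
case: (boolP (v \in F)) => /= vF; last by case: eqP vF => // ->; rewrite zF.
rewrite tent ?card_swap // in_swap zF andbT negb_or negbK [RHS]eq_sym.
by case: (eqVneq z u) uF => //= <-; rewrite zF.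
Qed.

Lemma in_tented m r (F : {set 'I_m.+1}) :
  reflect (exists G : {set 'I_m.+1}, [/\ ord_max \in G, #|G| = r.+1 & F \subset G])
    (F \in tented m r).
Proof.
rewrite inE; apply: (iffP exists_inP) => [[G] | [G [mG cG FG]]].
  rewrite inE => /existsP[H /and3P[mH /eqP cH /eqP ->]] FG.
  by exists (ord_max |: H); rewrite !inE eqxx cardsU1 mH cH.
exists G => //; rewrite inE; apply/existsP; exists (G :\ ord_max).
rewrite !inE eqxx setD1K // eqxx andbT /=.
by move: cG; rewrite (cardsD1 ord_max) mG add1n => -[->].
Qed.

(** By purity the (r+1)-element faces determine [K]. The relabeling is the transposition of [z] with
    the last vertex, an involution. *)
Lemma iso_tented m r (K : {set {set 'I_m.+1}}) :
  (forall A B : {set 'I_m.+1}, A \in K -> B \subset A -> B \in K) -> pure_dim K r ->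
  iso_complex K (tented m r) <->
  exists z, forall G : {set 'I_m.+1}, #|G| = r.+1 -> (G \in K) = (z \in G).
Proof.
move=> Kcl Kpure; split=> [[f [[g fK gK] fE]] | [z tent]].
  have imK (G : {set 'I_m.+1}) : f @: (g @: G) = G.
    by rewrite -imset_comp (eq_imset _ gK) imset_id.
  have g_inj := can_inj gK; have f_inj := can_inj fK.
  exists (f ord_max) => G cG; rewrite -{1}(imK G) -fE.
  have -> : (f ord_max \in G) = (ord_max \in g @: G).
    by rewrite -{1}(imK G) mem_imset.
  apply/in_tented/idP => [[H [mH cH GH]]|mG].
    suff -> : g @: G = H by [].
    by apply/eqP; rewrite eqEcard GH card_imset // cG cH leqnn.
  by exists (g @: G); rewrite card_imset.
pose f := tperm z ord_max.
have imK (G : {set 'I_m.+1}) : f @: (f @: G) = G.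
  by rewrite -imset_comp (eq_imset _ (tpermK z ord_max)) imset_id.
have f_inj : injective f := perm_inj.
exists f; split; first by exists f => x; exact: tpermK.
have zE : f ord_max = z by exact: tpermR.
have mE : f z = ord_max by exact: tpermL.
move=> F; apply/in_tented/idP => [[G [mG cG FG]]|].
  apply: Kcl (imsetS f FG); rewrite tent ?card_imset //.
  by rewrite -zE mem_imset.
case/(pure_face_ext Kpure)=> G; rewrite in_faces => /andP[GK /eqP cG] FG.
exists (f @: G); rewrite card_imset // -mE mem_imset // -tent // -[F]imK.
by split=> //; apply: imsetS.
Qed.

Lemma set2_swap (T : finType) (x y u : T) : x != y -> swap [set x; y] x u = [set u; y].
Proof.
move=> xy; apply/setP=> w; rewrite in_swap !inE; congr (_ || _).
by case: (eqVneq w x) => [->|] //=; rewrite (negPf xy).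
Qed.

(** For a graph the condition says that each vertex is adjacent to exactly one end of each edge.
    Vertices of the edge itself may be included, because [[set x; x]] is never a 1-face. *)
Lemma star1P (T : finType) (K : {set {set T}}) :
  (forall F u, F \in faces 1 K -> u \notin F -> #|miss K F u| = 1) <->
  (forall x y : T, [set x; y] \in faces 1 K ->
     forall u, ([set u; x] \in faces 1 K) = ([set u; y] \notin faces 1 K)).
Proof.
have irr x : [set x; x] \notin faces 1 K by rewrite in_faces setUid cards1 andbF.
have missE x y u : [set x; y] \in faces 1 K -> u \notin [set x; y] ->
    #|miss K [set x; y] u| = ([set u; y] \notin faces 1 K) + ([set u; x] \notin faces 1 K).
  move=> xyK uxy; have nxy : x != y by apply: contraTneq xyK => ->; apply: irr.
  have -> : ([set u; y] \in faces 1 K) = (swap [set x; y] x u \in K).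
    by rewrite -(set2_swap u nxy) swap_faces // !inE eqxx.
  have -> : ([set u; x] \in faces 1 K) = (swap [set x; y] y u \in K).
    have nyx : y != x by rewrite eq_sym.
    by rewrite -(set2_swap u nyx) [[set y; x]]setUC swap_faces // !inE eqxx orbT.
  rewrite -sum1_card big_mkcond /=.
  rewrite (bigD1 x) //= (bigD1 y) /= 1?eq_sym //= big1 ?addn0.
    by rewrite !(inE, in_set2) !eqxx orbT /=; do 2 case: (_ \in K).
  by move=> w /andP[wx wy]; rewrite !inE (negPf wx) (negPf wy).
split=> [star x y xyK u | adj F u FK uF].
  have [uxy|] := boolP (u \in [set x; y]).
    case/set2P: uxy => ->; first by rewrite xyK (negPf (irr x)).
    by rewrite setUC xyK irr.
  by move=> uxy; have := star _ _ xyK uxy; rewrite missE //; do 2 case: (_ \in _).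
have /cards2P[x [y [nxy FE]]] : #|F| == 2 by move: FK; rewrite in_faces => /andP[].
rewrite FE in FK uF *; rewrite missE // (adj x y FK u).
by case: (_ \in _).
Qed.

Lemma complete_bipartiteP (T : finType) (K : {set {set T}}) (F0 : {set T}) :
  F0 \in faces 1 K ->
  (forall F u, F \in faces 1 K -> u \notin F -> #|miss K F u| = 1) <-> complete_bipartite K.
Proof.
move=> F0K; have irr x : [set x; x] \notin faces 1 K.
  by rewrite in_faces setUid cards1 andbF.
split=> [/star1P adj | [A [_ _ KE]]].
  have /cards2P[x0 [y0 [nxy F0E]]] : #|F0| == 2 by move: F0K; rewrite in_faces => /andP[].
  (* One side is the neighbourhood of [y0]. Comparing [y0] with an edge shows that the edge crosses;
     comparing [y] outside [A] with the edge from [x] in [A] to [y0] shows that [x] and [y] are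
     adjacent. *)
  rewrite F0E in F0K; pose A := [set x | [set x; y0] \in faces 1 K].
  have AE x : (x \in A) = ([set x; y0] \in faces 1 K) by rewrite in_set.
  exists A; split.
  - by apply/set0Pn; exists x0; rewrite AE.
  - by apply/set0Pn; exists y0; rewrite in_setC AE.
  apply/setP=> F; apply/idP/imset2P => [FK | [x y]].
    have /cards2P[x [y [_ FE]]] : #|F| == 2 by move: FK; rewrite in_faces => /andP[].
    rewrite {}FE in FK *.
    have := adj x y FK y0; rewrite setUC -AE [[set y0; y]]setUC -AE => xyA.
    have [xA|xA] := boolP (x \in A).
      by exists x y; rewrite // in_setC -xyA.
    by exists y x; rewrite ?in_setC // 1?setUC //; move: xA; rewrite xyA negbK.
  rewrite in_setC !AE => xA yA ->.
  by rewrite setUC (adj x y0 xA y).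
apply/star1P.
have eE x y : ([set x; y] \in faces 1 K) = (x \in A) (+) (y \in A).
  rewrite KE; apply/imset2P/idP => [[a b aA]|].
    rewrite inE => bA E.
    have ab : a != b by apply: contraTneq aA => ->.
    have /set2P xE : x \in [set a; b] by rewrite -E !inE eqxx.
    have /set2P yE : y \in [set a; b] by rewrite -E !inE eqxx orbT.
    have /set2P aE : a \in [set x; y] by rewrite E !inE eqxx.
    have /set2P bE : b \in [set x; y] by rewrite E !inE eqxx orbT.
    by case: xE aA bA aE bE => -> aA bA; case: yE => -> // [] e1 [] e2;
      subst; rewrite ?aA ?(negPf bA) // ?eqxx in ab *.
  case: (boolP (x \in A)) => xA /= yA.
    by exists x y; rewrite // inE.
  by exists y x; rewrite // ?inE // setUC.
by move=> x y; rewrite eE => xy u; rewrite !eE; move: xy; do 3 case: (_ \in A).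
Qed.

End Recognition.

(** * The bound, its equality case and the classification *)

Theorem mainTheorem6 (R : realType) (r n : nat) (K : {set {set 'I_n}}) :
  (1 <= r)%N -> (r.+1 <= n)%N ->
  is_complex K -> pure_dim K r -> ~ contains_copy K (Delta r) ->
  exists q : R,
    q_sig r.-1 K q /\
    q <= (r * n)%:R - (r ^ 2)%:R + 1 /\
    (q = (r * n)%:R - (r ^ 2)%:R + 1 <->
       (forall (F : {set 'I_n}) (u : 'I_n),
          F \in faces r K -> u \notin F -> #|Nd r K F u| = r)) /\
    (r = 1%N ->
       (q = (r * n)%:R - (r ^ 2)%:R + 1 <-> complete_bipartite K)) /\
    ((2 <= r)%N -> ~~ odd r ->
       (q = (r * n)%:R - (r ^ 2)%:R + 1 <-> iso_complex K (tented n.-1 r))) /\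
    ((3 <= r)%N -> odd r ->
       q = (r * n)%:R - (r ^ 2)%:R + 1 ->
       iso_complex K (tented n.-1 r) \/ contains_copy K (rhombic r)).
Proof.
case: r => // s _; case: n K => // m K ltsm [Kcl Kvert] Kpure noDelta.
have miss_gt0 F u : F \in faces s.+1 K -> u \notin F -> (0 < #|miss K F u|)%N.
  move=> FK uF; rewrite lt0n cards_eq0; apply/eqP => m0.
  exact: noDelta (miss0_contains_Delta Kcl FK uF m0).
have [F0 F0K _] := pure_face_ext Kpure (Kvert ord0).
pose bnd := (s.+2 + (#|'I_m.+1| - s.+2) * s.+1)%N.
(* The bound becomes the natural number [bnd]; r <= n keeps the subtraction of r^2 exact. *)
have -> : (s.+1 * m.+1)%:R - (s.+1 ^ 2)%:R + 1 = bnd%:R :> R.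
  rewrite -natrB; last by rewrite -mulnn leq_mul2l /=; lia.
  by rewrite -[1]/(1%:R) -natrD /bnd card_ord; congr (_%:R); nia.
have ridge_gt0 : (0 < #|faces s K|)%N.
  move: F0K; rewrite in_faces => /andP[F0K /eqP cF0].
  have [v vF] : exists v, v \in F0 by apply/card_gt0P; rewrite cF0.
  apply/card_gt0P; exists (F0 :\ v); rewrite in_faces (Kcl F0) ?subsetDl //=.
  by move: cF0; rewrite (cardsD1 v) vF add1n => -[->].
have [q [evq qmax]] := sym_largest_eigenvalue (Qup_sym R s K) ridge_gt0.
have q_le := Qup_eigenvalue_le Kcl miss_gt0 evq.
pose star := forall F u, F \in faces s.+1 K -> u \notin F -> #|miss K F u| = 1%N.
have q_star : q = bnd%:R <-> star.
  split=> [qE | st].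
    by rewrite qE in evq; apply: (Qup_eigenvalue_eq Kcl miss_gt0 evq).
  apply/le_anti; rewrite q_le qmax //.
  apply: (Qup_eigen_updeg R Kcl F0K) => F FK.
  by apply/eqP/(sum_updeg_eq Kcl miss_gt0 FK) => u; apply: st.
have tent_or_rhombic : star -> iso_complex K (tented m s.+1) \/
    exists A u w, rhombus s.+1 K A u w.
  move=> st; case: (pselect (exists A u w, rhombus s.+1 K A u w)) => [|norh]; first by right.
  left; apply/iso_tented => //; apply: (tent_of_star st _ F0K) => A u w rh.
  by apply: norh; exists A, u, w.
exists q; split=> //; split=> //; split; [|split; [|split]].
- rewrite q_star; split=> st F u FK uF; have := card_Nd FK uF; last by rewrite st //; lia.
  by rewrite st //; lia.
- by move=> [s0]; move: F0K q_star; rewrite /star s0 => F0K ->; apply: complete_bipartiteP F0K.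
- move=> _ ev; rewrite q_star; split=> [st | /(iso_tented Kcl Kpure)[z tent]]; last exact: tent_star tent.
  case: (tent_or_rhombic st) => // -[A [u [w rh]]].
  by rewrite (rhombus_odd st rh) in ev.
- move=> _ _ /q_star st; case: (tent_or_rhombic st) => [|[A [u [w rh]]]]; first by left.
  by right; apply: rhombus_contains rh.
Qed.
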